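(* The deformed $q$-analog of the series $\sum_{n=1}^{\infty}n^2\binom{2n}{n}x^n=\frac{2x(2x+1)}{(1-4x)^{5/2}}$ is $$\sum_{n=1}^{\infty}\genfrac{[}{]}{0pt}{}{2n}{n}_{q}\frac{(1-q^{n})^2(-u/t)^{\binom{n}{2}}}{(-\sqrt{q};q)_{n}(-q;q)_{n}}\left(\frac{4x}{\sqrt{-t\varphi_{s,t}}}\right)^n$$ $$=\frac{4(1-\sqrt{q})x}{\sqrt{-t\varphi_{s,t}}}\;{}_{1}\Phi_{0}\left(\begin{array}{c} q\sqrt{q} \\ - \end{array};q,-\frac{u}{t},\frac{-4qux}{t\sqrt{-t\varphi_{s,t}}}\right)+\frac{4^2(\sqrt{q};q)_{2}\,u\,x^2}{t^2\varphi_{s,t}}\;{}_{1}\Phi_{0}\left(\begin{array}{c} q^2\sqrt{q} \\ - \end{array};q,-\frac{u}{t},\frac{-4u^2x}{t^2\sqrt{-t\varphi_{s,t}}}\right).$$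
   Context: Here $s,t$ are parameters, $\varphi_{s,t}=\frac{s+\sqrt{s^2+4t}}{2}$, $\varphi_{s,t}'=s-\varphi_{s,t}=-\frac{t}{\varphi_{s,t}}=\frac{s-\sqrt{s^2+4t}}{2}$, and $q=\varphi_{s,t}'/\varphi_{s,t}$; $u$ is the deformation parameter and $x$ is the variable. $(a;q)_0=1$ and $(a;q)_n=\prod_{k=0}^{n-1}(1-aq^k)$ for $n\ge1$. The $q$-binomial coefficient is $\genfrac{[}{]}{0pt}{}{n}{k}_{q}=\frac{(q;q)_n}{(q;q)_k(q;q)_{n-k}}$. The deformed basic hypergeometric series ${}_1\Phi_0$ is ${}_{1}\Phi_{0}\left(\begin{array}{c} a \\ - \end{array};q,v,z\right)=\sum_{n=0}^{\infty}v^{\binom n2}\frac{(a;q)_n}{(q;q)_n}z^n$.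
   Formalization: The printed identity is false (the coefficients of x differ by the factor 1-q); two formulas are corrected on the right: the first term gets the extra factor (1-q), and the argument of the second 1Phi0 is +4u^2x/(t^2 sqrt(-t phi)) instead of its negative. *)

(* Defs.v *)
From HB Require Import structures.
From mathcomp Require Import all_boot all_order all_algebra.
From mathcomp Require Export complex.
From mathcomp Require Import all_classical all_reals all_analysis.

Set Implicit Arguments.
Unset Strict Implicit.
Unset Printing Implicit Defensive.

Import Order.TTheory GRing.Theory Num.Theory numFieldNormedType.Exports.
Local Open Scope ring_scope.
Local Open Scope classical_set_scope.

Section Algebra.
Variable F : fieldType.
Implicit Types (a q v : F) (n k N : nat).

Definition qpoch a q n : F := \prod_(k < n) (1 - a * q ^+ k).

Definition qbinom q n k : F :=
  qpoch q q n / (qpoch q q k * qpoch q q (n - k)).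

Definition phi10_coef a q v n : F :=
  v ^+ 'C(n, 2) * (qpoch a q n / qpoch q q n).

(* 1Phi0(a; q, v, z) as an element of F[['X]], seen as the inverse limit of
   the F['X]/('X^N): when 'X divides z, the terms of index >= N vanish modulo
   'X^N. *)
Definition phi10_trunc N a q v (z : {poly F}) : {poly F} :=
  \sum_(0 <= n < N) phi10_coef a q v n *: z ^+ n.

(* Square roots are taken with respect to an arbitrary function rt choosing a
   square root of every element, so that no branch is preferred. *)
Definition phi_st (rt : F -> F) (s t : F) : F := (s + rt (s ^+ 2 + 4 * t)) / 2.

Definition phi_st' (rt : F -> F) (s t : F) : F := s - phi_st rt s t.

Definition q_st (rt : F -> F) (s t : F) : F := phi_st' rt s t / phi_st rt s t.

End Algebra.

Section Analysis.
Variable K : numFieldType.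
Implicit Types (a q v z : K) (n : nat).

Definition phi10_cvg a q v z : Prop :=
  cvgn (fun N => \sum_(0 <= n < N) phi10_coef a q v n * z ^+ n).

(* Meaningful only under phi10_cvg. *)
Definition phi10 a q v z : K :=
  limn (fun N => \sum_(0 <= n < N) phi10_coef a q v n * z ^+ n).

End Analysis.

(* Main.v *)
Require Import Defs.
From HB Require Import structures.
From mathcomp Require Import all_boot all_order all_algebra.
From mathcomp Require Import complex ring.
From mathcomp Require Import all_classical all_reals all_analysis.

Set Implicit Arguments.
Unset Strict Implicit.
Unset Printing Implicit Defensive.

Import Order.TTheory GRing.Theory Num.Theory numFieldNormedType.Exports.
Local Open Scope ring_scope.
Local Open Scope classical_set_scope.

(** Put r for the chosen square root of q, v = - u / t and c = 4 / w.  Since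
    1 - q^(2k+1) = (1 - r q^k) (1 + r q^k), the product (q;q)_(2n) factors as
    (r;q)_n (-r;q)_n (q;q)_n (-q;q)_n ([qpoch_double]).  Hence the central
    q-binomial coefficient divided by (-r;q)_n (-q;q)_n is (r;q)_n / (q;q)_n,
    and the left-hand coefficient collapses to
      v^C(n,2) (1 - q^n) (r;q)_n / (q;q)_(n-1)          ([central_coefS]).

    The two terms of the right-hand side come from the splitting
      1 - q^n = (1 - q) q^(n-1) + (1 - q^(n-1))         ([central_coefSS]).
    In the first summand, (r;q)_n = (1 - r) (qr;q)_(n-1) and
    C(n,2) = C(n-1,2) + (n-1) turn the coefficient into that of a 1Phi0 series
    of argument proportional to q v, shifted by one.  In the second,
    1 - q^(n-1) cancels the last factor of (q;q)_(n-1), while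
    (r;q)_n = (r;q)_2 (q^2 r;q)_(n-2) and C(n,2) = C(n-2,2) + 2(n-2) + 1 give
    a 1Phi0 series of argument proportional to v^2, shifted by two.

    This yields an exact identity between partial sums, valid in any
    commutative algebra ([sum_central_coef]).  Taken in the polynomials in x,
    and reduced modulo x^N, it is the formal identity ([central_coef_mod]);
    taken in the field of scalars, and passing to the limit, it is the analytic
    one ([central_coef_cvg]).  What remains is to rewrite the parameters of the
    statement in terms of v and c, using w^2 = - t phi, where phi and hence w
    are nonzero because phi phi' = - t ([phi_st_mul]). *)

Section QSeries.
Variable F : fieldType.
Implicit Types (a q r v : F) (n : nat).

Lemma qpoch0 a q : qpoch a q 0 = 1.
Proof. exact: big_ord0. Qed.

Lemma qpochS a q n : qpoch a q n.+1 = qpoch a q n * (1 - a * q ^+ n).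
Proof. exact: big_ord_recr. Qed.

Lemma qpoch_recl a q n : qpoch a q n.+1 = (1 - a) * qpoch (q * a) q n.
Proof.
rewrite /qpoch big_ord_recl expr0 mulr1; congr (_ * _).
by apply: eq_bigr => k _; rewrite /= exprS mulrA (mulrC a).
Qed.

Lemma qpoch_recl2 a q n :
  qpoch a q n.+2 = qpoch a q 2 * qpoch (q ^+ 2 * a) q n.
Proof. by rewrite !qpoch_recl qpoch0 mulr1 !mulrA. Qed.

Lemma qpoch_neq0 a q n : (forall k, a * q ^+ k != 1) -> qpoch a q n != 0.
Proof. by move=> h; apply/prodf_neq0 => k _; rewrite subr_eq0 eq_sym. Qed.

(** The factors of (q;q)_(2n) with odd exponent are
    1 - q^(2k+1) = (1 - r q^k) (1 + r q^k), and those with even exponent are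
    1 - q^(2k+2) = (1 - q^(k+1)) (1 + q^(k+1)). *)
Lemma qpoch_double q r n : r ^+ 2 = q ->
  qpoch q q (2 * n) =
    qpoch r q n * qpoch (- r) q n * (qpoch q q n * qpoch (- q) q n).
Proof.
move=> r2; elim: n => [|n IHn]; first by rewrite !qpoch0 !mulr1.
rewrite mulnS !qpochS IHn exprS mulSn mul1n exprD -r2.
by move: (_ ^+ n) => y; ring.
Qed.

(** The coefficient of the left-hand series, the scale factor of its argument
    apart. *)
Definition central_coef q r v n : F :=
  qbinom q (2 * n) n * ((1 - q ^+ n) ^+ 2 * v ^+ 'C(n, 2))
    / (qpoch (- r) q n * qpoch (- q) q n).

Variables q r v : F.
Hypothesis r2 : r ^+ 2 = q.
Hypothesis q_nroot : forall n, (0 < n)%N -> q ^+ n != 1.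

Lemma qpoch_qq_neq0 n : qpoch q q n != 0.
Proof. by apply: qpoch_neq0 => k; rewrite -exprS q_nroot. Qed.

(** In the next two lemmas, a vanishing factor squares to the forbidden
    equations q^(2k+2) = 1 and q^(2k+1) = 1 respectively. *)
Lemma qpoch_Nq_neq0 n : qpoch (- q) q n != 0.
Proof.
apply: qpoch_neq0 => k; apply: contra (q_nroot (n := (k.+1 * 2)%N) _) => //.
by rewrite mulNr -exprS exprM => /eqP e; rewrite -sqrrN e expr1n.
Qed.

Lemma qpoch_Nr_neq0 n : qpoch (- r) q n != 0.
Proof.
apply: qpoch_neq0 => k; apply: contra (q_nroot (n := (k * 2).+1) _) => //.
move=> /eqP e; have : (- r * q ^+ k) ^+ 2 = 1 by rewrite e expr1n.
by rewrite exprMn sqrrN r2 -exprM -exprS => ->.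
Qed.

(** One of the two factors 1 - q^(n+1) of the coefficient cancels the last
    factor of (q;q)_(n+1); the other is kept for the splitting below. *)
Lemma central_coefS n : central_coef q r v n.+1 =
  v ^+ 'C(n.+1, 2) * (1 - q ^+ n.+1) * (qpoch r q n.+1 / qpoch q q n).
Proof.
rewrite /central_coef /qbinom (qpoch_double _ r2) mul2n -addnn addnK.
have := qpoch_qq_neq0 n.+1; rewrite qpochS -exprS mulf_eq0 negb_or.
case/andP=> h1 h2; have h3 := qpoch_Nq_neq0 n.+1; have h4 := qpoch_Nr_neq0 n.+1.
move: (qpoch (- q) q _) (qpoch (- r) q _) (qpoch r q _) (qpoch q q n)
  (q ^+ _) (v ^+ _) h1 h2 h3 h4 => a b c d e f *.
by field; apply/and4P; split.
Qed.

Lemma central_coef1 :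
  central_coef q r v 1 = (1 - r) * (1 - q) * phi10_coef (q * r) q v 0.
Proof.
rewrite central_coefS /phi10_coef !qpochS !qpoch0 !expr0 expr1 invr1.
by ring.
Qed.

(** The contiguous relation behind the identity: 1 - q^(n+2) is split as
    (1 - q) q^(n+1) + (1 - q^(n+1)), whose summands feed the first and the
    second 1Phi0 series. *)
Lemma central_coefSS n : central_coef q r v n.+2 =
  (1 - r) * (1 - q) * (phi10_coef (q * r) q v n.+1 * (q * v) ^+ n.+1)
  + qpoch r q 2 * v * (phi10_coef (q ^+ 2 * r) q v n * (v ^+ 2) ^+ n).
Proof.
have -> : central_coef q r v n.+2 =
    v ^+ 'C(n.+2, 2) * ((1 - q) * q ^+ n.+1)
      * (qpoch r q n.+2 / qpoch q q n.+1)
    + v ^+ 'C(n.+2, 2) * (1 - q ^+ n.+1)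
      * (qpoch r q n.+2 / qpoch q q n.+1).
  by rewrite central_coefS (exprS q n.+1); ring.
congr (_ + _).
  rewrite /phi10_coef qpoch_recl binS bin1 exprD exprMn; ring.
have := qpoch_qq_neq0 n.+1; rewrite /phi10_coef qpoch_recl2 qpochS -exprS.
rewrite mulf_eq0 negb_or => /andP[h1 h2].
have -> : 'C(n.+2, 2) = ('C(n, 2) + (2 * n).+1)%N.
  by rewrite binS bin1 binS bin1 -addnA addnS addnn mul2n.
rewrite exprD exprS exprM.
move: (qpoch q q n) (q ^+ n.+1) h1 h2 => a b h1 h2.
by field; apply/andP; split.
Qed.

(** Having y in an arbitrary commutative algebra lets the same identity serve
    for y a multiple of the indeterminate and for y a scalar.  The three bounds
    differ so that the identity is exact: the two series on the right start at
    y and y^2. *)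
Lemma sum_central_coef (E : comAlgType F) (y : E) n :
  \sum_(1 <= k < n.+2) central_coef q r v k *: y ^+ k =
    ((1 - r) * (1 - q)) *: y
      * (\sum_(0 <= k < n.+1) phi10_coef (q * r) q v k *: ((q * v) *: y) ^+ k)
    + (qpoch r q 2 * v) *: y ^+ 2
      * (\sum_(0 <= k < n) phi10_coef (q ^+ 2 * r) q v k *: (v ^+ 2 *: y) ^+ k).
Proof.
rewrite big_add1 /= !big_nat_recl // central_coef1.
rewrite [(_ *: y) * _]mulrDr -addrA; congr (_ + _).
  by rewrite expr0 expr1 -scalerAr mulr1 scalerA mulrC.
rewrite !mulr_sumr -big_split; apply: eq_bigr => k _ /=.
rewrite central_coefSS scalerDl !exprZn !scalerA -!scalerAl -!scalerAr.
by rewrite !scalerA -exprS -exprD.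
Qed.

End QSeries.

Lemma phi10_truncS (F : fieldType) (N : nat) (a q v : F) (z : {poly F}) :
  phi10_trunc N.+1 a q v z =
    phi10_trunc N a q v z + phi10_coef a q v N *: z ^+ N.
Proof. by rewrite /phi10_trunc big_nat_recr. Qed.

(** The exact identity of partial sums has upper bounds N + 2, N + 1 and N in
    place of N throughout; the terms in excess are multiples of X^N. *)
Lemma central_coef_mod (F : fieldType) (q r v c : F) (N : nat) :
    r ^+ 2 = q -> (forall n : nat, (0 < n)%N -> q ^+ n != 1) ->
  (\sum_(1 <= n < N) central_coef q r v n *: (c *: 'X) ^+ n) %% 'X^N =
  (((1 - r) * (1 - q)) *: (c *: 'X)
      * phi10_trunc N (q * r) q v ((q * v) *: (c *: 'X))
    + (qpoch r q 2 * v) *: (c *: 'X) ^+ 2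
      * phi10_trunc N (q ^+ 2 * r) q v ((v ^+ 2) *: (c *: 'X))) %% 'X^N.
Proof.
move=> r2 hq.
(* The terms in excess on the left start at n = 1, so X^0 is set apart. *)
case: N => [|N]; first by rewrite expr0 !modp1.
have modD (p e : {poly F}) :
    'X^(N.+1) %| e -> (p + e) %% 'X^(N.+1) = p %% 'X^(N.+1).
  by move=> /eqP he; rewrite modpD he addr0.
have ZXn (b d : F) k : (N.+1 <= k)%N -> 'X^(N.+1) %| d *: (b *: 'X) ^+ k.
  by move=> hk; rewrite exprZn scalerA -mul_polyC dvdp_mull // dvdp_exp2l.
have := sum_central_coef v r2 hq (c *: 'X) N.+1.
rewrite 2?big_nat_recr //= -/(phi10_trunc N.+2 _ _ _ _).
rewrite -/(phi10_trunc N.+1 _ _ _ _) phi10_truncS.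
move=> /(congr1 (fun p : {poly F} => p %% 'X^(N.+1))).
rewrite !(modD _ (_ *: (c *: 'X) ^+ _)) ?ZXn // => ->.
rewrite mulrDr addrAC modD // dvdp_mull // scalerA ZXn //.
Qed.

Lemma cvg_shift_comb (K : numFieldType) (f g h : nat -> K) (a b : K) :
    cvgn f -> cvgn g -> (forall n, h n.+2 = a * f n.+1 + b * g n) ->
  cvgn h /\ limn h = a * limn f + b * limn g.
Proof.
move=> cf cg hE.
have H : h @ \oo --> a * limn f + b * limn g.
  rewrite -(cvg_shiftS h) -(cvg_shiftS (fun n => h n.+1)) /=.
  rewrite (_ : (fun n => _) = (fun n => a * f n.+1 + b * g n)); last first.
    by apply/funext => n; rewrite hE.
  apply: cvgD; apply: cvgMl_tmp => //; first by rewrite (cvg_shiftS f).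
split; first by apply/cvg_ex; eexists; exact: H.
by apply: cvg_lim H; exact: norm_hausdorff.
Qed.

Lemma central_coef_cvg (K : numFieldType) (q r v y : K) :
    r ^+ 2 = q -> (forall n : nat, (0 < n)%N -> q ^+ n != 1) ->
    phi10_cvg (q * r) q v (q * v * y) ->
    phi10_cvg (q ^+ 2 * r) q v (v ^+ 2 * y) ->
  let S := fun N => \sum_(1 <= n < N) central_coef q r v n * y ^+ n in
  cvgn S /\
  limn S = (1 - r) * (1 - q) * y * phi10 (q * r) q v (q * v * y)
           + qpoch r q 2 * v * y ^+ 2 * phi10 (q ^+ 2 * r) q v (v ^+ 2 * y).
Proof.
move=> r2 q_nroot cvg1 cvg2 S; apply: cvg_shift_comb => // n.
exact: (sum_central_coef v r2 q_nroot (y : K^o) n).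
Qed.

(** The two numbers are the roots of X^2 - s X - t. *)
Lemma phi_st_mul (F : fieldType) (rt : F -> F) (s t : F) :
    (forall z, rt z ^+ 2 = z) -> (2 : F) != 0 ->
  phi_st rt s t * phi_st' rt s t = - t.
Proof.
move=> rtK two_neq0; rewrite /phi_st' /phi_st.
have := rtK (s ^+ 2 + 4 * t); move: (rt _) => d hd.
rewrite (_ : s - (s + d) / 2 = (s - d) / 2); last first.
  by apply: (mulIf two_neq0); rewrite mulrBl !divfK //; ring.
rewrite mulf_div; apply: canLR (mulfK (mulf_neq0 two_neq0 two_neq0)) _.
by rewrite mulrC -subr_sqr hd; ring.
Qed.

Section Rescaling.
Variables (F : fieldType) (t u w phi : F).
Hypotheses (t_neq0 : t != 0) (w_neq0 : w != 0) (w2 : w ^+ 2 = - t * phi).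

Lemma rescale_arg1 q : - 4 * q * u / (t * w) = q * (- u / t) * (4 / w).
Proof. by field; rewrite t_neq0 w_neq0. Qed.

Lemma rescale_arg2 : 4 * u ^+ 2 / (t ^+ 2 * w) = (- u / t) ^+ 2 * (4 / w).
Proof. by field; rewrite t_neq0 w_neq0. Qed.

Lemma rescale_factor1 a b : 4 * a * b / w = a * b * (4 / w).
Proof. by ring. Qed.

(** Since w^2 = - t phi, the quotient u / (t^2 phi) is (- u / t) / w^2. *)
Lemma rescale_factor2 p :
  4 ^+ 2 * p * u / (t ^+ 2 * phi) = p * (- u / t) * (4 / w) ^+ 2.
Proof.
have -> : phi = - w ^+ 2 / t by rewrite w2; field.
by field; rewrite t_neq0 w_neq0 oppr_eq0 expf_neq0.
Qed.

End Rescaling.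

(* The first conjunct is the identity of formal power series in x, read modulo
   every power of x; the second is the identity of sums of complex series,
   wherever the two series 1Phi0 on the right-hand side converge.
   Two misprints of the source are corrected on the right-hand side: the factor
   (1 - q) of the first term, and the argument 4u^2x/(t^2 w) (not its opposite)
   of the second 1Phi0, as comparing the coefficients of x and x^3 shows. *)
Theorem theorem10 (R : realType) (rt : R[i] -> R[i])
    (rtK : forall z, rt z ^+ 2 = z) (s t u : R[i]) (t_neq0 : t != 0) :
  let phi := phi_st rt s t in
  let q := q_st rt s t in
  let rq := rt q in
  let w := rt (- t * phi) in
  let v := - u / t in
  (forall n : nat, (0 < n)%N -> q ^+ n != 1) ->
  let lhs_coef := fun n : nat =>
    qbinom q (2 * n)%N n * ((1 - q ^+ n) ^+ 2 * v ^+ 'C(n, 2))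
      / (qpoch (- rq) q n * qpoch (- q) q n) in
  (forall N : nat,
     (\sum_(1 <= n < N) lhs_coef n *: ((4 / w) *: 'X) ^+ n) %% 'X^N =
     ((4 * (1 - rq) * (1 - q) / w) *: 'X
        * phi10_trunc N (q * rq) q v ((- 4 * q * u / (t * w)) *: 'X)
      + (4 ^+ 2 * qpoch rq q 2 * u / (t ^+ 2 * phi)) *: 'X^2
        * phi10_trunc N (q ^+ 2 * rq) q v ((4 * u ^+ 2 / (t ^+ 2 * w)) *: 'X))
       %% 'X^N)
  /\
  (forall x : R[i],
     let z1 := - 4 * q * u * x / (t * w) in
     let z2 := 4 * u ^+ 2 * x / (t ^+ 2 * w) in
     phi10_cvg (q * rq) q v z1 ->
     phi10_cvg (q ^+ 2 * rq) q v z2 ->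
     let lhs_sum := fun N : nat =>
       \sum_(1 <= n < N) lhs_coef n * (4 * x / w) ^+ n : (R[i] : numFieldType) in
     cvgn lhs_sum /\
     limn lhs_sum =
        4 * (1 - rq) * (1 - q) * x / w * phi10 (q * rq) q v z1
        + 4 ^+ 2 * qpoch rq q 2 * u * x ^+ 2 / (t ^+ 2 * phi)
          * phi10 (q ^+ 2 * rq) q v z2).
Proof.
move=> phi q rq w v q_nroot lhs_coef.
have two_neq0 : (2 : R[i]) != 0 by rewrite pnatr_eq0.
have phi_neq0 : phi != 0.
  apply: contraNneq t_neq0 => phi0.
  by rewrite -oppr_eq0 -(phi_st_mul s t rtK two_neq0) -/phi phi0 mul0r.
have w2 : w ^+ 2 = - t * phi by exact: rtK.
have w_neq0 : w != 0 by rewrite -sqrf_eq0 w2 mulf_neq0 ?oppr_eq0.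
have rq2 : rq ^+ 2 = q by exact: rtK.
pose c := 4 / w.
have factor1 := rescale_factor1 w (1 - rq) (1 - q).
have factor2 := rescale_factor2 u t_neq0 w_neq0 w2 (qpoch rq q 2).
have arg1 := rescale_arg1 u t_neq0 w_neq0 q.
have arg2 := rescale_arg2 u t_neq0 w_neq0.
rewrite -/v -/c in factor1 factor2 arg1 arg2.
split=> [N|x z1 z2 cvg1 cvg2 lhs_sum].
  rewrite arg1 arg2 factor1 factor2.
  rewrite (central_coef_mod v c N rq2 q_nroot).
  by rewrite exprZn !scalerA.
have yE : c * x = 4 * x / w by rewrite /c mulrAC.
have z1E : z1 = q * v * (4 * x / w) by rewrite -yE mulrA -arg1 mulrAC.
have z2E : z2 = v ^+ 2 * (4 * x / w) by rewrite -yE mulrA -arg2 mulrAC.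
rewrite -[_ * x / w]mulrAC factor1 -[_ * x ^+ 2 / _]mulrAC factor2.
rewrite -[_ * c * x]mulrA -[_ * c ^+ 2 * x ^+ 2]mulrA -exprMn yE z1E z2E.
rewrite z1E in cvg1; rewrite z2E in cvg2.
exact: central_coef_cvg rq2 q_nroot cvg1 cvg2.
Qed.
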